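(* For $n\ge 0$ define the polynomial $$P_n(x_1,x_2,y_1,y_2,u_1,u_2,v_1,v_2,w_{\mathrm e},w_{\mathrm o},z_{\mathrm e},z_{\mathrm o})=\sum_{\sigma\in\mathfrak{D}_{2n}} x_1^{\mathrm{eareccpeak}(\sigma)}x_2^{\mathrm{eareccdfall}(\sigma)}y_1^{\mathrm{ereccval}(\sigma)}y_2^{\mathrm{ereccdrise}(\sigma)}u_1^{\mathrm{nrcpeak}(\sigma)}u_2^{\mathrm{nrcdfall}(\sigma)}v_1^{\mathrm{nrcval}(\sigma)}v_2^{\mathrm{nrcdrise}(\sigma)}w_{\mathrm e}^{\mathrm{evennrfix}(\sigma)}w_{\mathrm o}^{\mathrm{oddnrfix}(\sigma)}z_{\mathrm e}^{\mathrm{evenrar}(\sigma)}z_{\mathrm o}^{\mathrm{oddrar}(\sigma)}.$$ Then, as an identity of formal power series in $t$ with coefficients in the polynomial ring in these 12 variables, $\sum_{n\ge0}P_n\,t^n$ equals the T-type continued fraction with coefficients $\alpha_{2k-1}=[x_1+(k-1)u_1]\,[y_1+(k-1)v_1]$, $\alpha_{2k}=[x_2+(k-1)u_2+w_{\mathrm e}]\,[y_2+(k-1)v_2+w_{\mathrm o}]$ for $k\ge1$, $\delta_1=z_{\mathrm e}z_{\mathrm o}$, and $\delta_n=0$ for $n\ge2$.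
   Context: For $n\ge0$, a D-permutation of $[2n]=\{1,\dots,2n\}$ is a permutation $\sigma$ of $[2n]$ with $\sigma(2k-1)\ge 2k-1$ and $\sigma(2k)\le 2k$ for all $k\in[n]$; $\mathfrak{D}_{2n}$ is the set of them ($\mathfrak D_0$ consists of the empty permutation). For a permutation $\sigma$ and an index $i$: $i$ is a cycle peak if $\sigma^{-1}(i)<i>\sigma(i)$, a cycle valley if $\sigma^{-1}(i)>i<\sigma(i)$, a cycle double rise if $\sigma^{-1}(i)<i<\sigma(i)$, a cycle double fall if $\sigma^{-1}(i)>i>\sigma(i)$, a fixed point if $\sigma(i)=i$. The index $i$ is a record if $\sigma(j)<\sigma(i)$ for all $j<i$, an antirecord if $\sigma(j)>\sigma(i)$ for all $j>i$; an exclusive record is a record that is not an antirecord, an exclusive antirecord is an antirecord that is not a record, a record-antirecord is both, and a neither-record-antirecord is neither. Statistics: $\mathrm{eareccpeak}(\sigma)$ = number of indices that are exclusive antirecords and cycle peaks; $\mathrm{eareccdfall}$ = exclusive antirecords that are cycle double falls; $\mathrm{ereccval}$ = exclusive records that are cycle valleys; $\mathrm{ereccdrise}$ = exclusive records that are cycle double rises; $\mathrm{nrcpeak},\mathrm{nrcdfall},\mathrm{nrcval},\mathrm{nrcdrise}$ = neither-record-antirecords that are respectively cycle peaks, cycle double falls, cycle valleys, cycle double rises; $\mathrm{evennrfix},\mathrm{oddnrfix}$ = even, resp. odd, fixed points that are neither-record-antirecords; $\mathrm{evenrar},\mathrm{oddrar}$ = even, resp. odd, indices that are record-antirecords. Given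 sequences $(\alpha_n)_{n\ge1}$, $(\delta_n)_{n\ge1}$, the T-type continued fraction with these coefficients is the formal power series $$\cfrac{1}{1-\delta_1 t-\cfrac{\alpha_1 t}{1-\delta_2 t-\cfrac{\alpha_2 t}{1-\delta_3 t-\cdots}}}.$$ *)

(* Defs.v *)
From mathcomp Require Import all_boot all_order all_fingroup all_algebra.
From mathcomp Require Import zify.
From mathcomp Require Import mpoly.

Set Implicit Arguments.
Unset Strict Implicit.
Unset Printing Implicit Defensive.

Import GRing.Theory.
Local Open Scope ring_scope.

(* The index i of [N] = {1, ..., N} is represented by the element of 'I_N whose
   value is i - 1.  Comparisons are unaffected by this shift, but parities are
   flipped, hence the tests on i.+1 below. *)

Section Permutations.

Variable N : nat.
Implicit Types (s : {perm 'I_N}) (i : 'I_N).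

Local Open Scope nat_scope.

Definition odd_index i : bool := odd i.+1.
Definition even_index i : bool := ~~ odd i.+1.

Definition cpeak s i : bool := ((s^-1)%g i < i) && (s i < i).
Definition cval s i : bool := (i < (s^-1)%g i) && (i < s i).
Definition cdrise s i : bool := ((s^-1)%g i < i) && (i < s i).
Definition cdfall s i : bool := (i < (s^-1)%g i) && (s i < i).
Definition fixpt s i : bool := s i == i.

Definition record s i : bool := [forall j : 'I_N, (j < i) ==> (s j < s i)].
Definition antirecord s i : bool := [forall j : 'I_N, (i < j) ==> (s i < s j)].

Definition erec s i : bool := record s i && ~~ antirecord s i.
Definition earec s i : bool := antirecord s i && ~~ record s i.
Definition rar s i : bool := record s i && antirecord s i.
Definition nrar s i : bool := ~~ record s i && ~~ antirecord s i.

Definition eareccpeak s : nat := #|[set i | earec s i && cpeak s i]|.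
Definition eareccdfall s : nat := #|[set i | earec s i && cdfall s i]|.
Definition ereccval s : nat := #|[set i | erec s i && cval s i]|.
Definition ereccdrise s : nat := #|[set i | erec s i && cdrise s i]|.
Definition nrcpeak s : nat := #|[set i | nrar s i && cpeak s i]|.
Definition nrcdfall s : nat := #|[set i | nrar s i && cdfall s i]|.
Definition nrcval s : nat := #|[set i | nrar s i && cval s i]|.
Definition nrcdrise s : nat := #|[set i | nrar s i && cdrise s i]|.
Definition evennrfix s : nat :=
  #|[set i | [&& even_index i, nrar s i & fixpt s i]]|.
Definition oddnrfix s : nat :=
  #|[set i | [&& odd_index i, nrar s i & fixpt s i]]|.
Definition evenrar s : nat := #|[set i | even_index i && rar s i]|.
Definition oddrar s : nat := #|[set i | odd_index i && rar s i]|.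

End Permutations.

Definition Dperm (n : nat) : {set {perm 'I_(2 * n)}} :=
  [set s : {perm 'I_(2 * n)} |
    [forall i : 'I_(2 * n),
       (odd_index i ==> (i <= s i)%N) && (even_index i ==> (s i <= i)%N)]].

Definition Dpoly (R : comNzRingType)
    (x1 x2 y1 y2 u1 u2 v1 v2 we wo ze zo : R) (n : nat) : R :=
  \sum_(s in Dperm n)
     x1 ^+ eareccpeak s * x2 ^+ eareccdfall s
   * y1 ^+ ereccval s * y2 ^+ ereccdrise s
   * u1 ^+ nrcpeak s * u2 ^+ nrcdfall s
   * v1 ^+ nrcval s * v2 ^+ nrcdrise s
   * we ^+ evennrfix s * wo ^+ oddnrfix s
   * ze ^+ evenrar s * zo ^+ oddrar s.

(* A formal power series in t is given by its sequence of coefficients. *)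

Section PowerSeries.

Variable R : comNzRingType.

Definition fps := nat -> R.

Implicit Types f g : fps.

Definition fps_one : fps := fun n => (n == 0)%:R.

Definition fps_sub f g : fps := fun n => f n - g n.

Definition fps_mul f g : fps := fun n => \sum_(i < n.+1) f i * g (n - i)%N.

Definition fps_scale (c : R) f : fps := fun n => c * f n.

(* multiplication by t *)
Definition fps_shift f : fps := fun n => if n is m.+1 then f m else 0.

Definition fps_exp f (k : nat) : fps := iter k (fps_mul f) fps_one.

(* Geometric series \sum_k (1 - f)^k, for f with constant coefficient 1: then
   (1 - f)^k is divisible by t^k, so k <= n suffices in degree n.  See
   fps_mulV. *)
Definition fps_inv f : fps :=
  fun n => \sum_(k < n.+1) fps_exp (fps_sub fps_one f) k n.

Definition fps_eqn (n : nat) f g := forall m, (m < n)%N -> f m = g m.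

Lemma fps_mul_eqn n f f' g g' :
  fps_eqn n f f' -> fps_eqn n g g' -> fps_eqn n (fps_mul f g) (fps_mul f' g').
Proof.
move=> ff' gg' m ltmn; apply: eq_bigr => i _; rewrite ff' ?gg' //.
  exact: leq_ltn_trans (leq_subr _ _) ltmn.
by apply: leq_trans ltmn; rewrite ltn_ord.
Qed.

Lemma fps_exp_eqn n f f' k :
  fps_eqn n f f' -> fps_eqn n (fps_exp f k) (fps_exp f' k).
Proof. by move=> ff'; elim: k => [//|k IHk] /=; apply: fps_mul_eqn. Qed.

Lemma fps_inv_eqn n f g : fps_eqn n f g -> fps_eqn n (fps_inv f) (fps_inv g).
Proof.
move=> fg m ltmn; apply: eq_bigr => k _; apply: (@fps_exp_eqn n) => // j ltjn.
by rewrite /fps_sub fg.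
Qed.

Lemma fps_exp_small f k n : f 0%N = 0 -> (n < k)%N -> fps_exp f k n = 0.
Proof.
move=> f0; elim: k n => [//|k IHk] n lenk /=; rewrite /fps_mul.
rewrite big_ord_recl /= f0 mul0r add0r big1 // => i _.
rewrite IHk ?mulr0 //= /bump leq0n add1n.
by have := ltn_ord i; lia.
Qed.

Lemma fps_mulV f : f 0%N = 1 -> fps_mul f (fps_inv f) =1 fps_one.
Proof.
move=> f0 n; set g := fps_sub fps_one f.
have g0 : g 0%N = 0 by rewrite /g /fps_sub /fps_one f0 subrr.
have invE m : (m <= n)%N -> fps_inv f m = \sum_(k < n.+1) fps_exp g k m.
  move=> lemn; rewrite /fps_inv -/g -(big_mkord xpredT (fps_exp g ^~ m)).
  rewrite -(big_mkord xpredT (fps_exp g ^~ m)) [RHS](@big_cat_nat _ _ _ m.+1) //=.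
  rewrite [X in _ = _ + X]big_nat_cond [X in _ = _ + X]big1 ?addr0 //.
  by move=> k /andP[/andP[lt _] _]; rewrite fps_exp_small.
have fE m : f m = fps_one m - g m by rewrite /g /fps_sub opprB addrC subrK.
have mul1f h m : fps_mul fps_one h m = h m.
  rewrite /fps_mul big_ord_recl subn0 mul1r big1 ?addr0 // => i _.
  by rewrite /fps_one /= mul0r.
transitivity (\sum_(k < n.+1) (fps_exp g k n - fps_exp g k.+1 n)).
  rewrite /fps_mul (eq_bigr (fun i : 'I_n.+1 =>
    \sum_(k < n.+1) f i * fps_exp g k (n - i)%N)); last first.
    by move=> i _; rewrite invE ?leq_subr // mulr_sumr.
  rewrite exchange_big /=; apply: eq_bigr => k _.
  under eq_bigr => i _ do rewrite fE mulrBl.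
  by rewrite sumrB -/(fps_mul fps_one _ n) mul1f.
rewrite -(big_mkord xpredT (fun k => fps_exp g k n - fps_exp g k.+1 n)).
rewrite -[LHS]opprK -sumrN; under eq_bigr => k _ do rewrite opprB.
by rewrite telescope_sumr // opprB (@fps_exp_small g n.+1) // subr0.
Qed.

End PowerSeries.

(* T-type continued fractions.  The coefficient sequences are indexed from 1;
   the terms alpha 0 and delta 0 are not used. *)

Section TFraction.

Variables (R : comNzRingType) (alpha delta : nat -> R).

(* 1 - delta_j t - alpha_j t F *)
Definition Tfrac_denom (j : nat) (F : fps R) : fps R :=
  fps_sub (fps_sub (fps_one R) (fps_scale (delta j) (fps_shift (fps_one R))))
          (fps_scale (alpha j) (fps_shift F)).

(* k levels of the fraction that starts with delta_j and alpha_j, the rest of it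
   being replaced by 1 *)
Fixpoint Tfrac_trunc (k j : nat) : fps R :=
  if k is k'.+1 then fps_inv (Tfrac_denom j (Tfrac_trunc k' j.+1))
  else fps_one R.

(* The truncations converge in the t-adic topology: their coefficient of t^n is
   the same from k = n on (Tfrac_fromP). *)
Definition Tfrac_from (j : nat) : fps R := fun n => Tfrac_trunc n j n.

Definition Tfrac : fps R := Tfrac_from 1.

Lemma Tfrac_denom_eqn n j F G :
  fps_eqn n F G -> fps_eqn n.+1 (Tfrac_denom j F) (Tfrac_denom j G).
Proof.
by move=> FG [|m] ltmn; rewrite /Tfrac_denom /fps_sub /fps_scale //= FG.
Qed.

Lemma Tfrac_denom0 j F : Tfrac_denom j F 0%N = 1.
Proof. by rewrite /Tfrac_denom /fps_sub /fps_scale /= !mulr0 !subr0. Qed.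

Lemma Tfrac_trunc_eqn k l j :
  (k <= l)%N -> fps_eqn k.+1 (Tfrac_trunc k j) (Tfrac_trunc l j).
Proof.
elim: k l j => [|k IHk] [|l] j //= lekl.
  case=> // _; rewrite /fps_inv big_ord1 //.
by apply: fps_inv_eqn; apply: Tfrac_denom_eqn; apply: IHk.
Qed.

Lemma Tfrac_fromP k j n : (n <= k)%N -> Tfrac_trunc k j n = Tfrac_from j n.
Proof. by move=> lenk; rewrite [RHS](Tfrac_trunc_eqn j lenk). Qed.

Lemma Tfrac_from_rec j :
  fps_mul (Tfrac_denom j (Tfrac_from j.+1)) (Tfrac_from j) =1 fps_one R.
Proof.
move=> n; rewrite -(fps_mulV (Tfrac_denom0 j (Tfrac_from j.+1)) n).
apply: (@fps_mul_eqn _ n.+1) => // m ltmn.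
have lemn1 : (m <= n.+1)%N by apply: ltnW.
rewrite -(Tfrac_fromP j lemn1) [Tfrac_trunc n.+1 j]/=.
have eqF : fps_eqn n (Tfrac_trunc n j.+1) (Tfrac_from j.+1).
  by move=> q ltqn; apply: Tfrac_fromP; apply: ltnW.
exact: (fps_inv_eqn (Tfrac_denom_eqn j eqF)).
Qed.

End TFraction.

(* Main.v *)
(* An excedance is never an antirecord, an anti-excedance is never a record, and
   a fixed point is a record iff it is an antirecord.  Hence the weight of a
   D-permutation is a product of weights of single indices.  Read a permutation
   by revealing row and column k for k = 0, 1, ...; the h positions already read
   whose images are still unknown are open, and so are h values.  An
   anti-excedance at k picks one of the open values, and is an antirecord iff it
   picks the smallest: total weight x + (h - 1) u.  An excedance j gets its image
   when the value s j is read, and is a record iff j is then the smallest open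
   position.  Its cycle type is fixed at the earlier time j, but the sum over all
   completions is a product over the open positions (the potential) times a
   weighted count of Motzkin paths, and the potential reproduces itself when a
   position is closed.  So P_n counts weighted paths of length 2n from 0 to 0.

   Write F_j for the tail of the T-fraction starting at level j.  The products
   F_1 ... F_j satisfy the linear recurrence
     F_1 ... F_j = F_1 ... F_{j-1} + delta_j t F_1 ... F_j
                   + alpha_j t F_1 ... F_{j+1},
   which is, up to scalars, that of the path sums by starting height. *)
Require Import Defs.
From mathcomp Require Import all_boot all_order all_fingroup all_algebra.
From mathcomp Require Import zify ring.
From mathcomp Require Import mpoly.

Set Implicit Arguments.
Unset Strict Implicit.
Unset Printing Implicit Defensive.

Import GRing.Theory.
Local Open Scope ring_scope.

(** * Choices among open positions, graded by whether the smallest one is taken *)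

Section Potential.

Variables (R : comNzRingType) (N : nat).
Implicit Types (A B : {set 'I_N}) (e : 'I_N -> bool -> R) (i j m v : 'I_N).

(** Total weight of [h.+1] choices of which exactly one, the smallest, is a record or antirecord. *)
Definition lev (x : bool -> R) (h : nat) : R := x true + x false *+ h.

Definition below A m : bool := [forall i in A, (m <= i)%N].

(* Reading from the right, the open position j would have one choice making it a
   record and one more for each smaller open position. *)
Definition pot e A : R :=
  \prod_(j in A) lev (e j) #|[set i in A | (i < j)%N]|.

Lemma eq_pot e e' A : {in A, e =1 e'} -> pot e A = pot e' A.
Proof. by move=> ee'; apply: eq_bigr => j /ee' ->. Qed.

Lemma potU1 e A m :
  (forall i, i \in A -> (i < m)%N) -> pot e (m |: A) = pot e A * lev (e m) #|A|.
Proof.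
move=> Am; have mA : m \notin A by apply/negP => /Am; rewrite ltnn.
rewrite /pot big_setU1 //= mulrC; congr (_ * lev _ _); last first.
  apply: eq_card => i; rewrite !inE; case: eqP => [->|_] /=.
    by rewrite ltnn (negPf mA).
  by case: (boolP (i \in A)) => //= /Am.
apply: eq_bigr => j jA; congr lev; apply: eq_card => i; rewrite !inE.
by case: eqP => [->|_] //=; rewrite (negPf mA) ltnNge (ltnW (Am _ jA)).
Qed.

(** Adding elements in increasing order leaves the earlier factors of [pot] and the earlier values
    of [below] unchanged, except that the first element is added to the empty set. *)
Lemma set_max_ind (P : {set 'I_N} -> Prop) :
  P set0 ->
  (forall m A, (forall i, i \in A -> (i < m)%N) -> P A -> P (m |: A)) ->
  forall A, P A.
Proof.
move=> P0 PU A; have [n] := ubnP #|A|; elim: n A => // n IHn A ltAn.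
have [->//|[i0 i0A]] := set_0Vmem A.
case: (@arg_maxnP _ i0 (mem A) val i0A) => m inA mmax.
have mA : m \in A by [].
rewrite -(setD1K mA); apply: PU => [i|].
  rewrite !inE => /andP[im iA]; rewrite ltn_neqAle im.
  exact: mmax.
by apply: IHn; rewrite (cardsD1 m) mA in ltAn.
Qed.

Lemma belowU1 A m i : A != set0 -> (forall j, j \in A -> (j < m)%N) ->
  below (m |: A) i = below A i.
Proof.
move=> /set0Pn[a aA] Am; apply/forall_inP/forall_inP => H j.
  by move=> jA; apply: H; rewrite !inE jA orbT.
rewrite !inE => /orP[/eqP->|/H//].
by apply: leq_trans (H _ aA) (ltnW (Am _ aA)).
Qed.

Lemma below_max A m : (forall j, j \in A -> (j < m)%N) ->
  below (m |: A) m = (A == set0).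
Proof.
move=> Am; apply/forall_inP/eqP => [H|-> j].
  apply/setP=> j; rewrite inE; apply/negP => jA.
  by have:= H j; rewrite !inE jA orbT => /(_ isT); rewrite leqNgt Am.
by rewrite !inE orbF => /eqP->.
Qed.

(** Only the minimum of [A] satisfies [below A]. *)
Lemma sum_below (x : bool -> R) A : A != set0 ->
  \sum_(v in A) x (below A v) = lev x #|A|.-1.
Proof.
elim/set_max_ind: A => [|m A Am IH _]; first by rewrite eqxx.
have mA : m \notin A by apply/negP => /Am; rewrite ltnn.
rewrite big_setU1 //= below_max // cardsU1 mA /=.
have [->|A0] := eqVneq A set0.
  by rewrite big_set0 cards0 /lev mulr0n !addr0.
rewrite (eq_bigr (fun i => x (below A i))); last by move=> i _; rewrite belowU1.
rewrite IH // /lev -[in RHS](prednK (n := #|A|)) ?card_gt0 // mulrSr; ring.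
Qed.

(** The potential reproduces itself. Let [m] be a new maximum. Removing [j] from below [m] lowers
    the rank of [m] by one, so these terms give all of [pot e (m |: A)] but one summand [e m false]
    of the last factor, and removing [m] itself supplies that summand. *)
Lemma sum_pot e A : A != set0 ->
  \sum_(j in A) e j (below A j) * pot e (A :\ j) = pot e A.
Proof.
elim/set_max_ind: A => [|m A Am IH _]; first by rewrite eqxx.
have mA : m \notin A by apply/negP => /Am; rewrite ltnn.
rewrite big_setU1 //= below_max // setU1K // potU1 //.
have [->|A0] := eqVneq A set0.
  by rewrite big_set0 cards0 /lev mulr0n !addr0 mulrC.
rewrite (eq_bigr (fun j => e j (below A j) * pot e (A :\ j)
                             * lev (e m) #|A|.-1)); last first.
  move=> j jA; rewrite belowU1 // -mulrA; congr (_ * _).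
  have -> : (m |: A) :\ j = m |: (A :\ j).
    apply/setP=> i; rewrite !inE; case: eqP => // ->.
    by case: eqP => // jm; rewrite -jm jA in mA.
  rewrite potU1; last by move=> i /setD1P[_ /Am].
  by rewrite (cardsD1 j A) jA.
rewrite -mulr_suml IH // /lev -[in RHS](prednK (n := #|A|)) ?card_gt0 //.
rewrite mulrSr; ring.
Qed.

End Potential.

(** * Partially read permutations and the refinement of their cylinders *)

Section Cylinders.

Variable N : nat.
Implicit Types (k l : nat) (f : 'I_N -> 'I_N) (A : {set 'I_N}).
Implicit Types (s : {perm 'I_N}) (i j v : 'I_N).

(* The permutations whose restriction to positions < k and values < l is the
   partial map f, the positions in A being those that are sent to values >= l. *)
Definition cyl k l f A s : bool :=
  [forall i : 'I_N, (i < k)%N ==> if i \in A then (l <= s i)%N else s i == f i].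

Definition partial_inj k l f A : Prop :=
  [/\ forall i, i \in A -> (i < k)%N,
      forall i, (i < k)%N -> i \notin A -> (f i < l)%N
    & {in [pred i : 'I_N | (i < k)%N && (i \notin A)] &, injective f}].

(** The open values: already read, but not yet attained. *)
Definition free_vals k l f A : {set 'I_N} :=
  [set v : 'I_N | (v < l)%N] :\: f @: [set i : 'I_N | (i < k)%N && (i \notin A)].

Lemma cylP k l f A s :
  reflect (forall i, (i < k)%N ->
             if i \in A then is_true (l <= s i)%N else s i = f i)
          (cyl k l f A s).
Proof.
apply: (iffP forallP) => H i; first move=> lik.
  by have /implyP/(_ lik) := H i; case: ifP => // _ /eqP.
by apply/implyP => /H; case: ifP => // _ ->.
Qed.

Lemma free_valsP k l f A v :
  reflect ((v < l)%N /\ forall i, (i < k)%N -> i \notin A -> f i <> v)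
          (v \in free_vals k l f A).
Proof.
rewrite !inE andbC; apply: (iffP andP) => -[lvl H]; split=> //.
  by move=> i lik iA fi; case/negP: H; apply/imsetP; exists i; rewrite ?inE ?lik.
apply/imsetP=> -[i]; rewrite inE => /andP[lik iA] /esym; exact: H.
Qed.

Lemma card_ord_lt k : (k <= N)%N -> #|[set i : 'I_N | (i < k)%N]| = k.
Proof.
move=> lekN; have -> : [set i : 'I_N | (i < k)%N] = widen_ord lekN @: [set: 'I_k].
  apply/setP=> i; rewrite inE; apply/idP/imsetP => [lik|[j _ ->]] /=.
    by exists (Ordinal lik); [rewrite inE | apply: ord_inj].
  exact: ltn_ord.
rewrite card_imset ?cardsT ?card_ord // => i j eqij.
by apply: ord_inj; have := congr1 val eqij.
Qed.

(** The closed positions and the values they take are equinumerous. For [k = l] there are thus as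
    many open values as open positions. *)
Lemma card_free_vals k l f A : (k <= N)%N -> (l <= N)%N -> partial_inj k l f A ->
  (#|free_vals k l f A| + k = #|A| + l)%N.
Proof.
move=> lekN lelN [Ak fl finj].
set D := [set i : 'I_N | (i < k)%N && (i \notin A)].
have sfD : f @: D \subset [set v : 'I_N | (v < l)%N].
  by apply/subsetP=> _ /imsetP[i + ->]; rewrite !inE => /andP[]; apply: fl.
have cB : (#|free_vals k l f A| + #|D| = l)%N.
  rewrite -[RHS](card_ord_lt lelN) /free_vals cardsD (setIidPr sfD).
  rewrite -/D -(card_in_imset (f := f) (D := D)) ?subnK ?subset_leq_card //.
  by move=> i j; rewrite !inE => Di Dj; apply: finj; rewrite inE.
have cD : (#|A| + #|D| = k)%N.
  rewrite -[RHS](card_ord_lt lekN) -cardsUI addnC.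
  have -> : A :&: D = set0.
    by apply/setP=> i; rewrite !inE; case: (i \in A); rewrite ?andbF.
  rewrite cards0 add0n; apply: eq_card => i; rewrite !inE.
  by case: (boolP (i \in A)) => /= [/Ak ->|]; rewrite ?andbT.
by rewrite -[X in (_ + X)%N]cD -[X in _ = (_ + X)%N]cB addnCA addnA.
Qed.

Section Row.

Variables (k : 'I_N) (l : nat) (f : 'I_N -> 'I_N) (A : {set 'I_N}).
Hypothesis okA : partial_inj k l f A.

Let kA : k \notin A.
Proof. by have [Ak _ _] := okA; apply/negP=> /Ak; rewrite ltnn. Qed.

Lemma partial_inj_row_open : partial_inj k.+1 l f (k |: A).
Proof.
have [Ak fl finj] := okA.
have Dk i : (i < k.+1)%N -> i \notin k |: A -> (i < k)%N && (i \notin A).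
  rewrite !inE negb_or => lik /andP[nik ->]; rewrite andbT.
  by rewrite ltn_neqAle (nik : val i != k).
split=> [i|i lik iA|i j /andP[lik iA] /andP[ljk jA]].
- by rewrite !inE => /orP[/eqP->//|/Ak/ltnW].
- by have /andP[] := Dk i lik iA; apply: fl.
by apply: finj; apply: Dk.
Qed.

Lemma partial_inj_row_close v : v \in free_vals k l f A ->
  partial_inj k.+1 l [eta f with k |-> v] A.
Proof.
have [Ak fl finj] := okA => /free_valsP[lvl vf].
have Dk i : (i < k.+1)%N -> i != k -> (i < k)%N.
  by move=> lik nik; rewrite ltn_neqAle (nik : val i != k).
split=> [i /Ak/ltnW//|i lik iA|i j /andP[lik iA] /andP[ljk jA]] /=.
  by case: eqP => // /eqP nik; apply: fl; rewrite ?Dk.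
case: eqP => [->|/eqP/(Dk i lik) ik]; case: eqP => [->//|/eqP/(Dk j ljk) jk].
- by move=> /esym/vf-/(_ jk jA).
- by move=> /vf-/(_ ik iA).
by apply: finj; rewrite inE ?ik ?jk.
Qed.

Lemma cyl_row_open s :
  cyl k.+1 l f (k |: A) s = cyl k l f A s && (l <= s k)%N.
Proof.
apply/cylP/andP => [H|[/cylP H lk] i]; first split.
- apply/cylP=> i lik; have := H i (ltnW lik); rewrite !inE.
  by case: eqP lik => // ->; rewrite ltnn.
- by have := H k (ltnSn _); rewrite !inE eqxx.
rewrite ltnS leq_eqVlt !inE => /orP[/eqP/ord_inj->|lik]; first by rewrite eqxx.
by case: eqP lik => [->|_ /H]; rewrite ?ltnn.
Qed.

Lemma cyl_row_close v s :
  cyl k.+1 l [eta f with k |-> v] A s = cyl k l f A s && (s k == v).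
Proof.
apply/cylP/andP => [H|[/cylP H /eqP skv] i]; first split.
- apply/cylP=> i lik; have /= := H i (ltnW lik).
  by case: eqP lik => // ->; rewrite ltnn.
- by have /= := H k (ltnSn _); rewrite (negPf kA) eqxx => ->.
rewrite ltnS leq_eqVlt /= => /orP[/eqP/ord_inj->|lik].
  by rewrite (negPf kA) eqxx.
by case: eqP lik => [->|_ /H]; rewrite ?ltnn.
Qed.

(** Reading position [k]: either its image is at least [l] and [k] becomes open, or it takes one of
    the open values. *)
Lemma sum_cyl_row (R : nmodType) (F : {perm 'I_N} -> R) :
  \sum_(s | cyl k l f A s) F s =
    \sum_(s | cyl k.+1 l f (k |: A) s) F s
    + \sum_(v in free_vals k l f A)
        \sum_(s | cyl k.+1 l [eta f with k |-> v] A s) F s.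
Proof.
rewrite (bigID (fun s : {perm 'I_N} => l <= s k)%N) /=; congr (_ + _).
  by apply: eq_bigl => s; rewrite cyl_row_open.
rewrite (partition_big (fun s : {perm 'I_N} => s k) (mem (free_vals k l f A))).
  apply: eq_bigr => v /free_valsP[lvl _]; apply: eq_bigl => s.
  rewrite cyl_row_close -andbA; congr (_ && _).
  by case: eqP => [->|_]; rewrite ?andbF // -ltnNge lvl.
move=> s /andP[/cylP H]; rewrite -ltnNge => lskl; apply/free_valsP; split=> //.
move=> i lik iA fi; have := H i lik; rewrite (negPf iA) fi => /perm_inj ik.
by rewrite ik ltnn in lik.
Qed.

End Row.

Section Column.

Variables (k : nat) (l : 'I_N) (f : 'I_N -> 'I_N) (A : {set 'I_N}).
Hypothesis okA : partial_inj k l f A.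

Lemma partial_inj_col_open : partial_inj k l.+1 f A.
Proof.
have [Ak fl finj] := okA; split=> // i lik iA; exact: leqW (fl i lik iA).
Qed.

Lemma partial_inj_col_close j : j \in A ->
  partial_inj k l.+1 [eta f with j |-> l] (A :\ j).
Proof.
have [Ak fl finj] := okA => jA.
have DA i : i \notin A :\ j -> i != j -> i \notin A.
  by rewrite !inE => + nij; rewrite nij.
have fneq i : (i < k)%N -> i \notin A -> f i <> l.
  by move=> lik iA fil; have := fl i lik iA; rewrite fil ltnn.
split=> [i /setD1P[_ /Ak]//|i lik iA|i i' /andP[lik iA] /andP[lik' iA']] /=.
  by case: eqP => [_|/eqP/(DA i iA) iA1]; rewrite ?leqnn // ltnW // ltnS fl.
case: eqP => [->|/eqP/(DA i iA) iA1]; case: eqP => [->//|/eqP/(DA i' iA') iA1'].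
- by move=> /esym/fneq-/(_ lik' iA1').
- by move=> /fneq-/(_ lik iA1).
by apply: finj; rewrite inE ?lik ?lik'.
Qed.

Lemma cyl_col_open s :
  cyl k l.+1 f A s = cyl k l f A s && (k <= (s^-1)%g l)%N.
Proof.
have [Ak fl finj] := okA.
apply/cylP/andP => [H|[/cylP H lk] i lik]; first split.
- by apply/cylP=> i lik; have := H i lik; case: ifP => // _ /ltnW.
- rewrite leqNgt; apply/negP => lik; have := H _ lik; rewrite permKV.
  case: ifP => [_|/negbT iA fil]; first by rewrite ltnn.
  by have := fl _ lik iA; rewrite -fil ltnn.
have := H i lik; case: ifP => // iA; rewrite leq_eqVlt => /orP[/eqP/ord_inj sil|//].
by rewrite sil permK leqNgt lik in lk.
Qed.

Lemma cyl_col_close j s : j \in A ->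
  cyl k l.+1 [eta f with j |-> l] (A :\ j) s = cyl k l f A s && (s j == l).
Proof.
have [Ak fl finj] := okA => jA.
apply/cylP/andP => [H|[/cylP H /eqP sjl] i lik]; first split.
- apply/cylP=> i lik; have /= := H i lik; rewrite !inE.
  case: eqP => [-> /=|_ /=]; first by rewrite jA => ->.
  by case: ifP => // _ /ltnW.
- by have /= := H j (Ak j jA); rewrite !inE eqxx /= => ->.
rewrite !inE /=; case: eqP => [-> //|/eqP nij] /=.
have := H i lik; case: ifP => // iA; rewrite leq_eqVlt => /orP[/eqP/ord_inj sil|//].
by rewrite -(perm_inj (etrans sjl sil)) eqxx in nij.
Qed.

(** Reading value [l]: its preimage is either an unread position or one of the open ones. *)
Lemma sum_cyl_col (R : nmodType) (F : {perm 'I_N} -> R) :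
  \sum_(s | cyl k l f A s) F s =
    \sum_(s | cyl k l.+1 f A s) F s
    + \sum_(j in A)
        \sum_(s | cyl k l.+1 [eta f with j |-> l] (A :\ j) s) F s.
Proof.
have [Ak fl finj] := okA.
rewrite (bigID (fun s : {perm 'I_N} => k <= (s^-1)%g l)%N) /=; congr (_ + _).
  by apply: eq_bigl => s; rewrite cyl_col_open.
rewrite (partition_big (fun s : {perm 'I_N} => (s^-1)%g l) (mem A)).
  apply: eq_bigr => j jA; apply: eq_bigl => s.
  rewrite cyl_col_close // -andbA; congr (_ && _).
  rewrite -[s j == l](inj_eq (@perm_inj _ (s^-1)%g)) permK [RHS]eq_sym.
  by case: eqP => [->|_]; rewrite ?andbF // -ltnNge Ak.
move=> s /andP[/cylP H]; rewrite -ltnNge => lik.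
have := H _ lik; case: ifP => // /negbT iA; rewrite permKV => fil.
by have := fl _ lik iA; rewrite -fil ltnn.
Qed.

End Column.

End Cylinders.

(** * From weighted permutations to weighted Motzkin paths *)

Section WeightedCount.

Variables (R : comNzRingType) (W : nat -> bool -> R) (E G : nat -> bool -> bool -> R).

(** The first flag tells a valley from a double rise in [E], and a peak from a double fall in
    [G]. *)
Definition wt N (s : {perm 'I_N}) (i : 'I_N) : R :=
  if s i == i then W i (record s i)
  else if (i < s i)%N then E i (i < (s^-1)%g i)%N (record s i)
  else G i ((s^-1)%g i < i)%N (antirecord s i).

(* Weighted Motzkin paths of length r from height h down to 0, where k is the
   index of the first step. *)
Fixpoint path_sum (r k h : nat) : R :=
  if r is r'.+1 then
    lev (E k true) h * path_sum r' k.+1 h.+1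
    + if h is h'.+1 then
        (lev (E k false) h' + lev (G k false) h' + W k false)
          * path_sum r' k.+1 h
        + lev (G k true) h' * path_sum r' k.+1 h'
      else W k true * path_sum r' k.+1 0
  else (h == 0)%:R.

Section Records.

Variables (N : nat) (k : 'I_N) (f : 'I_N -> 'I_N) (A : {set 'I_N}).
Variable (s : {perm 'I_N}).
Hypotheses (okA : partial_inj k k f A) (cyls : cyl k k f A s).

Lemma record_fix : s k = k -> record s k = (A == set0).
Proof.
have [Ak fl finj] := okA; move/cylP: cyls => H skk.
apply/forallP/eqP => [rec|A0 j].
  apply/setP=> j; rewrite inE; apply/negP=> jA.
  have /implyP/(_ (Ak _ jA)) := rec j.
  by have := H _ (Ak _ jA); rewrite jA skk leqNgt => /negPf->.
apply/implyP => ljk; have := H _ ljk; rewrite A0 inE skk => ->.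
by apply: fl; rewrite // A0 inE.
Qed.

(** Closed positions have images below [k], open ones other than [j] have images above it, so only
    an open position before [j] can spoil the record. *)
Lemma record_close j : j \in A -> s j = k -> record s j = below A j.
Proof.
have [Ak fl finj] := okA; move/cylP: cyls => H jA sjk.
apply/forallP/forall_inP => [rec i iA|bel i].
  rewrite leqNgt; apply/negP=> lij; have /implyP/(_ lij) := rec i.
  by have := H _ (Ak _ iA); rewrite iA sjk leqNgt => /negPf->.
apply/implyP => lij; have lik := ltn_trans lij (Ak _ jA).
have := H _ lik; case: ifP => [/bel|/negbT iA ->]; first by rewrite leqNgt lij.
by rewrite sjk; apply: fl.
Qed.

(** Dually, a later position whose image is below [v] must take an open value, and every open value
    other than [v] is taken later. *)
Lemma antirecord_close v : v \in free_vals k k f A -> s k = v ->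
  antirecord s k = below (free_vals k k f A) v.
Proof.
have [Ak fl finj] := okA; move/cylP: cyls => H vB skv.
have [lvk _] := free_valsP _ _ _ _ _ vB.
apply/forallP/forall_inP => [arec b bB|bel j].
  have [lbk bf] := free_valsP _ _ _ _ _ bB.
  rewrite leqNgt; apply/negP=> lbv; pose j := (s^-1)%g b.
  have sj : s j = b by rewrite permKV.
  have lkj : (k < j)%N.
    rewrite ltn_neqAle; apply/andP; split.
      by apply/eqP=> /ord_inj kj; rewrite -sj -kj skv ltnn in lbv.
    rewrite leqNgt; apply/negP => ljk; have := H _ ljk; rewrite sj.
    by case: ifP => [_|/negbT jA /esym]; [rewrite leqNgt lbk | apply: bf].
  by have /implyP/(_ lkj) := arec j; rewrite sj skv ltnNge (ltnW lbv).
apply/implyP=> lkj; have [lksj|lsjk] := leqP k (s j).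
  by rewrite skv; apply: leq_trans lksj.
rewrite ltn_neqAle skv bel ?andbT.
  by apply/eqP => /ord_inj; rewrite -skv => /perm_inj kj; rewrite kj ltnn in lkj.
apply/free_valsP; split=> // i lik iA fi; have := H _ lik.
rewrite (negPf iA) fi => /perm_inj ij; rewrite -ij ltnNge (ltnW lik) // in lkj.
Qed.

End Records.

Lemma wt_exc N (s : {perm 'I_N}) (i : 'I_N) : (i < s i)%N ->
  wt s i = E i (i < (s^-1)%g i)%N (record s i).
Proof. by rewrite /wt; case: eqP => [->|_ ->]; rewrite ?ltnn. Qed.

Lemma wt_aexc N (s : {perm 'I_N}) (i : 'I_N) : (s i < i)%N ->
  wt s i = G i ((s^-1)%g i < i)%N (antirecord s i).
Proof.
by rewrite /wt; case: eqP => [->|_]; rewrite ?ltnn // [(i < s i)%N]ltnNge => /ltnW->.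
Qed.

(* The weight of the positions that are not yet read or still open. *)
Definition pending N k (A : {set 'I_N}) (s : {perm 'I_N}) : R :=
  \prod_(i : 'I_N | (k <= i)%N || (i \in A)) wt s i.

Lemma pending_open N (k : 'I_N) A s : pending k A s = pending k.+1 (k |: A) s.
Proof.
apply: eq_bigl => i; rewrite !inE leq_eqVlt [_ == i :> nat]eq_sym.
by rewrite -(inj_eq val_inj) /= orbA [(i == k :> nat) || _]orbC.
Qed.

Lemma pending_close N k (A : {set 'I_N}) s (j : 'I_N) : (j < k)%N -> j \in A ->
  pending k A s = wt s j * pending k (A :\ j) s.
Proof.
move=> ljk jA; rewrite /pending (bigD1 j) ?jA ?orbT //=; congr (_ * _).
apply: eq_bigl => i; rewrite !inE andb_orl; case: eqP => [->|_]; last first.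
  by rewrite !andbT.
by rewrite !andbF leqNgt ljk.
Qed.

Lemma pending_row N (k : 'I_N) (A : {set 'I_N}) s : k \notin A ->
  pending k A s = wt s k * pending k.+1 A s.
Proof.
move=> kA; rewrite pending_open (@pending_close _ _ _ _ k) ?setU11 // setU1K //.
Qed.

Lemma cyl_full N (f : 'I_N -> 'I_N) :
  injective f -> exists p, forall s, cyl N N f set0 s = (s == p).
Proof.
move=> finj; exists (perm finj) => t; apply/cylP/eqP => [H|-> i _].
  by apply/permP=> i; rewrite permE; have := H i (ltn_ord i); rewrite inE.
by rewrite inE permE.
Qed.

(** Induction on the number [r] of unread indices. The function [e j] is the weight of the open
    position [j] with its cycle type already settled; only its record status is still
    undetermined. *)
Lemma cyl_sum N r k (f : 'I_N -> 'I_N) (A : {set 'I_N}) (e : 'I_N -> bool -> R) :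
  (r + k)%N = N -> partial_inj k k f A ->
  (forall s, cyl k k f A s -> forall j, j \in A -> wt s j = e j (record s j)) ->
  \sum_(s | cyl k k f A s) pending k A s = pot e A * path_sum r k #|A|.
Proof.
elim: r k f A e => [|r IHr] k f A e.
  (* Everything is read: without open positions one permutation is left, otherwise none. *)
  rewrite add0n => ->; have [-> [_ _ finj] _|[j jA] _ _] := set_0Vmem A.
    have finj' : injective f.
      by move=> i j; apply: finj; rewrite inE ltn_ord inE.
    have [p cylE] := cyl_full finj'.
    rewrite (big_pred1 p) // /pending /pot big_set0 cards0 mul1r big_pred0 //.
    by move=> i; rewrite inE orbF leqNgt ltn_ord.
  rewrite big_pred0 => [|s]; last first.
    by apply/cylP=> /(_ j (ltn_ord j)); rewrite jA leqNgt ltn_ord.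
  have An0 : A != set0 by apply/set0Pn; exists j.
  by rewrite /= cards_eq0 (negPf An0) mulr0.
move=> Nrk; have ltkN : (k < N)%N by rewrite -Nrk addSn ltnS leq_addl.
have /IHr IH : (r + k.+1)%N = N by rewrite addnS.
pose K := Ordinal ltkN; rewrite -[k]/(K : nat) in IH *; move: IH.
move: K => {k ltkN Nrk} K IH okA eA.
have [Ak fl finj] := okA.
have KA : K \notin A by apply/negP => /Ak; rewrite ltnn.
have okr := partial_inj_row_open okA.
have okv v := @partial_inj_row_close _ _ _ _ _ okA v.
set B := free_vals K K f A in okv *.
have cB : #|B| = #|A|.
  have leKN := ltnW (ltn_ord K).
  exact: addIn (card_free_vals leKN leKN okA).
(* Reading row [K] and then column [K] gives five cases: valley, fixed point ([K] closed by its own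
   value), double rise, double fall and peak. *)
rewrite sum_cyl_row // sum_cyl_col // big_setU1 //= setU1K //.
under [X in _ + X]eq_bigr => v vB do rewrite (sum_cyl_col (okv v vB)).
rewrite big_split /=.
have valE : \sum_(s | cyl K.+1 K.+1 f (K |: A) s) pending K A s =
    pot e A * lev (E K true) #|A| * path_sum r K.+1 #|A|.+1.
  under eq_bigr => s _ do rewrite pending_open.
  (* The position [K] opens as a valley, which fixes its cycle type in [e]. *)
  rewrite (IH _ _ [eta e with K |-> E K true]).
  - rewrite potU1 //= eqxx cardsU1 KA; congr (_ * _ * _).
    by apply: eq_pot => i iA /=; case: eqP iA KA => // -> ->.
  - exact: partial_inj_col_open.
  move=> s; rewrite cyl_col_open // cyl_row_open // => /andP[/andP[cs lKs] lKs'].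
  move=> j /setU1P[->|jA] /=; last first.
    by case: eqP jA KA => [-> ->//|_ jA _]; apply: eA.
  rewrite eqxx wt_exc ?lKs' // ltn_neqAle lKs andbT.
  by apply/eqP => /ord_inj sK; rewrite {2}sK permK ltnn in lKs'.
have fixE : \sum_(s | cyl K.+1 K.+1 [eta f with K |-> K] A s) pending K A s =
    W K (A == set0) * (pot e A * path_sum r K.+1 #|A|).
  rewrite -(IH [eta f with K |-> K] A e).
  - rewrite mulr_sumr; apply: eq_bigr => s.
    rewrite -{1}(setU1K KA) cyl_col_close ?setU11 // cyl_row_open //.
    move=> /andP[/andP[cs _] /eqP sK].
    by rewrite pending_row // /wt sK eqxx (record_fix okA).
  - by have := partial_inj_col_close okr (setU11 K A); rewrite setU1K.
  move=> s; rewrite -{1}(setU1K KA) cyl_col_close ?setU11 // cyl_row_open //.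
  by move=> /andP[/andP[cs _] _] j; apply: eA.
have riseE j : j \in A ->
    \sum_(s | cyl K.+1 K.+1 [eta f with j |-> K] ((K |: A) :\ j) s) pending K A s =
    e j (below A j) * pot e (A :\ j)
      * (lev (E K false) #|A|.-1 * path_sum r K.+1 #|A|).
  move=> jA; have jKA : j \in K |: A by rewrite !inE jA orbT.
  have nKj : K != j by apply: contraNneq KA => ->.
  have eqA : (K |: A) :\ j = K |: (A :\ j).
    by apply/setP=> i; rewrite !inE; case: (i =P j) => // ->; rewrite eq_sym (negPf nKj).
  have cA : #|A :\ j| = #|A|.-1 by rewrite (cardsD1 j A) jA.
  have KAj : K \notin A :\ j by rewrite !inE (negPf KA) andbF.
  (* Position [j] closes while [K] opens as a double rise, so the height is kept. *)
  transitivity (e j (below A j) *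
     (pot [eta e with K |-> E K false] (K |: (A :\ j)) * path_sum r K.+1 #|A|)).
    have -> : #|A| = #|(K |: A) :\ j|.
      by rewrite eqA cardsU1 KAj cA add1n prednK // card_gt0; apply/set0Pn; exists j.
    rewrite -eqA -(IH [eta f with j |-> K]).
    - rewrite mulr_sumr; apply: eq_bigr => s.
      rewrite cyl_col_close // cyl_row_open // => /andP[/andP[cs _] /eqP sj].
      rewrite pending_open (@pending_close _ _ _ _ j) // ?ltnS 1?ltnW ?Ak //.
      by rewrite eA // (record_close okA).
    - exact: partial_inj_col_close.
    move=> s; rewrite cyl_col_close // cyl_row_open // => /andP[/andP[cs lKs] /eqP sj].
    move=> i; rewrite eqA => /setU1P[->|] /=; last first.
      move=> /setD1P[_ iA]; case: eqP iA KA => [-> ->//|_ iA _]; exact: eA.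
    have s'K : (s^-1)%g K = j by rewrite -sj permK.
    have ltKjF : (K < j)%N = false by rewrite ltnNge ltnW ?Ak.
    rewrite eqxx wt_exc ?s'K ?ltKjF // ltn_neqAle lKs andbT.
    by apply: contraNneq nKj => /ord_inj sK; rewrite -s'K {2}sK permK.
  rewrite potU1 /= ?eqxx; last by move=> i /setD1P[_ /Ak].
  rewrite cA !mulrA; congr (_ * _ * _ * _).
  by apply: eq_pot => i iA /=; case: eqP iA KAj => // -> ->.
have fallE v : v \in B ->
    \sum_(s | cyl K.+1 K.+1 [eta f with K |-> v] A s) pending K A s =
    G K false (below B v) * (pot e A * path_sum r K.+1 #|A|).
  move=> vB; have okvB := okv v vB; have [lvK _] := free_valsP _ _ _ _ _ vB.
  rewrite -(IH [eta f with K |-> v] A e).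
  - rewrite mulr_sumr; apply: eq_bigr => s.
    rewrite cyl_col_open // cyl_row_close // => /andP[/andP[cs /eqP sK] lKs'].
    by rewrite pending_row // wt_aexc ?sK // (antirecord_close okA cs vB) // ltnNge (ltnW lKs').
  - exact: partial_inj_col_open.
  move=> s; rewrite cyl_col_open // cyl_row_close // => /andP[/andP[cs _] _] j.
  exact: eA.
have peakE v j : v \in B -> j \in A ->
    \sum_(s | cyl K.+1 K.+1 [eta [eta f with K |-> v] with j |-> K] (A :\ j) s)
       pending K A s =
    G K true (below B v) * (e j (below A j) * pot e (A :\ j)
      * path_sum r K.+1 #|A|.-1).
  move=> vB jA; have okvB := okv v vB; have [lvK _] := free_valsP _ _ _ _ _ vB.
  have -> : #|A|.-1 = #|A :\ j| by rewrite (cardsD1 j A) jA.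
  rewrite -mulrA -(IH [eta [eta f with K |-> v] with j |-> K] (A :\ j) e).
  - rewrite !mulr_sumr; apply: eq_bigr => s.
    rewrite cyl_col_close // cyl_row_close // => /andP[/andP[cs /eqP sK] /eqP sj].
    have s'K : (s^-1)%g K = j by rewrite -sj permK.
    rewrite pending_row // wt_aexc ?sK // s'K Ak // (antirecord_close okA cs vB) //.
    rewrite (@pending_close _ _ _ _ j) // ?ltnS 1?ltnW ?Ak //.
    by rewrite eA // (record_close okA).
  - exact: partial_inj_col_close.
  move=> s; rewrite cyl_col_close // cyl_row_close // => /andP[/andP[cs _] _] i.
  by move=> /setD1P[_ iA]; apply: eA.
rewrite valE fixE (eq_bigr _ riseE) (eq_bigr _ fallE).
under [X in _ + (_ + X)]eq_bigr => v vB do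
  rewrite (eq_bigr _ (fun j => @peakE v j vB)) -mulr_sumr -mulr_suml.
rewrite -!mulr_suml /=.
(* At height 0 only the valley and the fixed point remain; [sum_pot] and [sum_below] need a nonempty
   set. *)
have [A0|An0] := eqVneq A set0.
  have B0 : B = set0 by apply/eqP; rewrite -cards_eq0 cB A0 cards0.
  rewrite B0 !big_set0 A0 big_set0 cards0 /=; ring.
have Bn0 : B != set0 by rewrite -card_gt0 cB card_gt0.
rewrite sum_pot // !sum_below // cB.
rewrite -[#|A|](prednK (n := #|A|)) ?card_gt0 //=; ring.
Qed.

Lemma perm_wt_sum N : \sum_(s : {perm 'I_N}) \prod_i wt s i = path_sum N 0 0.
Proof.
have ok0 : partial_inj 0 0 (@id 'I_N) set0 by split=> // i; rewrite inE.
have := @cyl_sum N N 0 id set0 (fun _ _ => 0) (addn0 N) ok0.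
rewrite /pot big_set0 cards0 mul1r => <- => [|s _ j]; last by rewrite inE.
apply: eq_big => [s|s _]; last by apply: eq_bigl => i.
by apply/esym/cylP.
Qed.

End WeightedCount.

(** * Products of tails of the T-fraction *)

Section FormalSeries.

Variable R : comNzRingType.
Implicit Types f g h : fps R.

(** Truncation to polynomials, from which associativity is inherited. *)
Lemma fps_mulE m n f g : (n <= m)%N ->
  fps_mul f g n = ((\poly_(i < m.+1) f i) * (\poly_(i < m.+1) g i))`_n.
Proof.
move=> lenm; rewrite coefM; apply: eq_bigr => i _; rewrite !coef_poly !ltnS.
by rewrite (leq_trans (leq_ord i) lenm) (leq_trans (leq_subr _ _) lenm).
Qed.

Lemma fps_mulA f g h : fps_mul f (fps_mul g h) =1 fps_mul (fps_mul f g) h.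
Proof.
move=> n; pose P (f : fps R) := \poly_(i < n.+1) f i.
transitivity (P f * (P g * P h))`_n.
  rewrite coefM; apply: eq_bigr => i _; rewrite -fps_mulE ?leq_subr //.
  by rewrite coef_poly ltn_ord.
rewrite mulrA coefM; apply: eq_bigr => i _; rewrite -fps_mulE ?leq_ord //.
by rewrite coef_poly ltnS leq_subr.
Qed.

Lemma fps_mul1 f : fps_mul (fps_one R) f =1 f.
Proof.
move=> n; rewrite /fps_mul big_ord_recl subn0 mul1r big1 ?addr0 // => i _.
by rewrite /fps_one /= mul0r.
Qed.

Lemma fps_mul_subl f g h n :
  fps_mul (fps_sub f g) h n = fps_mul f h n - fps_mul g h n.
Proof. by rewrite -sumrB; apply: eq_bigr => i _; rewrite mulrBl. Qed.

Lemma fps_mul_scalel c f g n : fps_mul (fps_scale c f) g n = c * fps_mul f g n.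
Proof. by rewrite mulr_sumr; apply: eq_bigr => i _; rewrite mulrA. Qed.

Lemma fps_mul_shiftl f g n : fps_mul (fps_shift f) g n.+1 = fps_mul f g n.
Proof. by rewrite /fps_mul big_ord_recl mul0r add0r. Qed.

Variables alpha delta : nat -> R.

Fixpoint Tfrac_prod (j : nat) : fps R :=
  if j is j'.+1 then fps_mul (Tfrac_from alpha delta j) (Tfrac_prod j')
  else fps_one R.

Lemma Tfrac_prod0 j : Tfrac_prod j 0%N = 1.
Proof. by elim: j => //= j IHj; rewrite /fps_mul big_ord1 IHj mulr1. Qed.

Lemma Tfrac_prod1 n : Tfrac_prod 1 n = Tfrac alpha delta n.
Proof.
rewrite /= /fps_mul big_ord_recr /= subnn mulr1 big1 ?add0r // => i _.
by rewrite /fps_one subn_eq0 leqNgt ltn_ord mulr0.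
Qed.

(** The denominator at level [j.+1] times the tail starting there is 1; insert this in front of
    [Tfrac_prod j] and expand the denominator. *)
Lemma Tfrac_prodS j n :
  Tfrac_prod j.+1 n.+1 = Tfrac_prod j n.+1 + delta j.+1 * Tfrac_prod j.+1 n
                         + alpha j.+1 * Tfrac_prod j.+2 n.
Proof.
set F := Tfrac_from alpha delta.
have -> : Tfrac_prod j n.+1 =
    fps_mul (Tfrac_denom alpha delta j.+1 (F j.+2)) (Tfrac_prod j.+1) n.+1.
  rewrite /= fps_mulA -[LHS]fps_mul1; apply: eq_bigr => i _.
  by rewrite Tfrac_from_rec.
rewrite !fps_mul_subl !fps_mul_scalel fps_mul1 !fps_mul_shiftl fps_mul1.
by rewrite -/(Tfrac_prod j.+2) addrAC addrNK addrNK.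
Qed.

End FormalSeries.

Arguments Tfrac_prod : simpl never.

(** * D-permutations: weights, path recurrence and statistics *)

Section Dpermutations.

Variables (R : comNzRingType) (x1 x2 y1 y2 u1 u2 v1 v2 we wo ze zo : R).

Definition fix_wt (k : nat) (rec : bool) : R :=
  if odd k.+1 then if rec then zo else wo else if rec then ze else we.

(** The zero weights, here at even indices and in [aexc_wt] at odd ones, kill every permutation
    outside [Dperm]. *)
Definition exc_wt (k : nat) (valley rec : bool) : R :=
  if odd k.+1 then
    if valley then if rec then y1 else v1 else if rec then y2 else v2
  else 0.

Definition aexc_wt (k : nat) (peak antirec : bool) : R :=
  if odd k.+1 then 0
  else if peak then if antirec then x1 else u1 else if antirec then x2 else u2.

Section Paths.

Variables alpha delta : nat -> R.
Hypothesis alpha_odd : forall h,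
  alpha (2 * h).+1 = (x1 + u1 *+ h) * (y1 + v1 *+ h).
Hypothesis alpha_even : forall h,
  alpha (2 * h).+2 = (x2 + u2 *+ h + we) * (y2 + v2 *+ h + wo).
Hypotheses (delta1 : delta 1%N = ze * zo) (delta0 : forall j, delta j.+2 = 0).

Let T := Tfrac_prod alpha delta.
Let P := path_sum fix_wt exc_wt aexc_wt.
(** The weight of the fastest descent from height [h] at an even [k] (0-based): a level step at even
    [k], then a down step at odd [k], repeated [h] times. *)
Let d h := \prod_(i < h) ((y2 + v2 *+ i + wo) * (x1 + u1 *+ i)).

Let T_odd h n : T (2 * h).+3 n.+1 =
  T (2 * h).+2 n.+1
  + (x1 + u1 *+ h.+1) * (y1 + v1 *+ h.+1) * T (2 * h).+4 n.
Proof.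
have := alpha_odd h.+1; rewrite mulnS => <-.
by rewrite /T Tfrac_prodS delta0 mul0r addr0.
Qed.

Let T_even h n : T (2 * h).+2 n.+1 =
  T (2 * h).+1 n.+1
  + (x2 + u2 *+ h + we) * (y2 + v2 *+ h + wo) * T (2 * h).+3 n.
Proof. by rewrite -alpha_even /T Tfrac_prodS delta0 mul0r addr0. Qed.

Let T_one n : T 1 n.+1 = ze * zo * T 1 n + x1 * y1 * T 2 n.
Proof.
have := alpha_odd 0; rewrite muln0 !mulr0n !addr0 => <-.
by rewrite /T Tfrac_prodS delta1 -[Tfrac_prod _ _ 0 _]/(fps_one R n.+1) add0r.
Qed.

Let P_rec r k h : P r.+1 k h =
  lev (exc_wt k true) h * P r k.+1 h.+1
  + if h is h'.+1 then
      (lev (exc_wt k false) h' + lev (aexc_wt k false) h' + fix_wt k false)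
        * P r k.+1 h
      + lev (aexc_wt k true) h' * P r k.+1 h'
    else fix_wt k true * P r k.+1 0.
Proof. by []. Qed.

(* The generating function in t of the paths from height h at an even index is
   d_h t^h F_1 ... F_{2h+1}, where F_j is the tail of the fraction starting at
   level j; one step later it is (x1 + h u1) d_h t^h F_1 ... F_{2h+2} from
   height h + 1. *)
Lemma path_sum_Tfrac m a h :
  P (2 * m) (2 * a) h = if (h <= m)%N then d h * T (2 * h).+1 (m - h)%N else 0.
Proof.
elim: m a h => [|m IHm] a h.
  rewrite muln0 leqn0 /P [LHS]/=; case: eqP => // ->.
  by rewrite /d big_ord0 mul1r subnn /T Tfrac_prod0.
have od b : odd (2 * b) = false by rewrite mul2n odd_double.
have dS i : d i.+1 = d i * ((y2 + v2 *+ i + wo) * (x1 + u1 *+ i)).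
  by rewrite /d big_ord_recr.
have odd0 : P (2 * m).+1 (2 * a).+1 0 = ze * T 1 m.
  have := IHm a.+1 0%N; rewrite mulnS subn0 /d big_ord0 mul1r => Pm.
  rewrite P_rec Pm /lev /exc_wt /fix_wt /= od /=; ring.
(* At an odd 0-based index no up step has nonzero weight; the level and down steps combine through
   [T_even]. *)
have oddS i : P (2 * m).+1 (2 * a).+1 i.+1 =
    if (i <= m)%N then (x1 + u1 *+ i) * d i * T (2 * i).+2 (m - i)%N else 0.
  have := IHm a.+1 i.+1; have := IHm a.+1 i; rewrite [(2 * a.+1)%N]mulnS => P1 P2.
  rewrite P_rec P1 P2 /lev /exc_wt /fix_wt /aexc_wt /= od /=.
  case: (ltngtP i m) => [lim|lmi|->]; last first.
  - by rewrite subnn /T !Tfrac_prod0; ring.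
  - by ring.
  rewrite -(subnSK lim) T_even mulnS add2n dS; ring.
rewrite mulnS add2n P_rec; case: h => [|h].
  rewrite odd0 oddS subn0 /d big_ord0 /lev /exc_wt /fix_wt /= od /= subn0 T_one.
  ring.
rewrite !oddS /lev /exc_wt /fix_wt /aexc_wt /= od /= ltnS subSS dS mulnS.
(* For [h = m] only constant coefficients, all equal to 1, occur; for [h > m] too few steps are left
   to come down. *)
case: (ltngtP h m) => [lhm|lmh|->]; last first.
- by rewrite subnn /T !Tfrac_prod0; ring.
- by ring.
rewrite -(subnSK lhm) T_odd add2n; ring.
Qed.

End Paths.

(** Pigeonhole: [s] injects the positions before [i] into the values below [s i]. *)
Lemma record_ge N (s : {perm 'I_N}) i : record s i -> (i <= s i)%N.
Proof.
move=> /forallP rec; rewrite -(card_ord_lt (ltnW (ltn_ord i))).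
rewrite -(card_ord_lt (ltnW (ltn_ord (s i)))) -(card_imset _ (@perm_inj _ s)).
apply/subset_leq_card/subsetP => _ /imsetP[j + ->]; rewrite !inE => ji.
exact: implyP (rec j) ji.
Qed.

Lemma antirecord_le N (s : {perm 'I_N}) i : antirecord s i -> (s i <= i)%N.
Proof.
move=> /forallP arec; rewrite leqNgt; apply/negP => lisi.
have leC : (#|~: [set j : 'I_N | (j < i.+1)%N]|
              <= #|~: [set j : 'I_N | (j < (s i).+1)%N]|)%N.
  rewrite -[leqRHS](card_preimset _ (@perm_inj _ s)).
  apply/subset_leq_card/subsetP=> j; rewrite !inE -!leqNgt => lij.
  exact: implyP (arec j) lij.
have := cardsC [set j : 'I_N | (j < i.+1)%N].
have := cardsC [set j : 'I_N | (j < (s i).+1)%N].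
by rewrite !card_ord_lt ?ltn_ord //; lia.
Qed.

(** Either property makes the set of indices on one side of [i] stable under [s]. By finiteness [s]
    permutes that set, hence also the other side. *)
Lemma record_antirecord_fix N (s : {perm 'I_N}) i :
  s i = i -> record s i = antirecord s i.
Proof.
move=> si.
have stable (S : {set 'I_N}) : {in S, forall j, s j \in S} ->
    forall j, (s j \in S) = (j \in S).
  move=> sS j; have sub : s @: S \subset S.
    by apply/subsetP=> _ /imsetP[x xS ->]; apply: sS.
  have /eqP sSE : s @: S == S.
    by rewrite eqEcard sub (card_imset _ (@perm_inj _ s)) leqnn.
  by rewrite -{1}sSE (mem_imset _ _ (@perm_inj _ s)).
have sneq j : (i == s j :> nat) = (i == j :> nat).
  by rewrite -{1}si !(inj_eq (@ord_inj N)) (inj_eq perm_inj).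
apply/forallP/forallP => H j; apply/implyP => ij; rewrite si.
  have sji : (s j < i)%N = (j < i)%N.
    have := stable [set j : 'I_N | (j < i)%N] _ j; rewrite !inE; apply=> x.
    by rewrite !inE => xi; have /implyP/(_ xi) := H x; rewrite si.
  by rewrite ltn_neqAle sneq (ltn_eqF ij) leqNgt sji -leqNgt ltnW.
have sij : (i < s j)%N = (i < j)%N.
  have := stable [set j : 'I_N | (i < j)%N] _ j; rewrite !inE; apply=> x.
  by rewrite !inE => ix; have /implyP/(_ ix) := H x; rewrite si.
by rewrite ltn_neqAle eq_sym sneq (gtn_eqF ij) leqNgt sij -leqNgt ltnW.
Qed.

Lemma expr_card_set (I : finType) (p : pred I) (x : R) :
  x ^+ #|[set i | p i]| = \prod_i (if p i then x else 1).
Proof. by rewrite -big_mkcond /= prodr_const cardsE. Qed.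

Lemma Dperm_wt n (s : {perm 'I_(2 * n)}) : s \in Dperm n ->
     x1 ^+ eareccpeak s * x2 ^+ eareccdfall s
   * y1 ^+ ereccval s * y2 ^+ ereccdrise s
   * u1 ^+ nrcpeak s * u2 ^+ nrcdfall s
   * v1 ^+ nrcval s * v2 ^+ nrcdrise s
   * we ^+ evennrfix s * wo ^+ oddnrfix s
   * ze ^+ evenrar s * zo ^+ oddrar s
  = \prod_i wt fix_wt exc_wt aexc_wt s i.
Proof.
rewrite inE => /forallP sD.
(* Each power becomes a product over indices, so the claim can be checked at a single [i], by the
   sign of [s i - i]. *)
rewrite !expr_card_set -!big_split /=; apply: eq_bigr => i _.
have /andP[/implyP oD /implyP eD] := sD i.
rewrite /wt /fix_wt /exc_wt /aexc_wt /earec /erec /nrar /rar.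
rewrite /cpeak /cval /cdrise /cdfall /fixpt -/(odd_index i).
rewrite -[even_index i]/(~~ odd_index i) in eD *.
have s'iE : (s i == i) = ((s^-1)%g i == i).
  by rewrite -[RHS](inj_eq (@perm_inj _ s)) permKV eq_sym.
have [si|ltsi|gtsi] := ltngtP (s i) i; last first.
- have si : s i = i by apply: ord_inj.
  have s'i : (s^-1)%g i = i by apply/eqP; rewrite -s'iE si.
  rewrite si s'i eqxx ltnn record_antirecord_fix // !andbF /=.
  by case: (odd_index i); case: (antirecord s i); rewrite /= ?mulr1 ?mul1r.
- have arF : antirecord s i = false.
    by apply/negP=> /antirecord_le; rewrite leqNgt ltsi.
  have od : odd_index i = true.
    by case: (boolP (odd_index i)) => // /eD; rewrite leqNgt ltsi.
  move: s'iE; rewrite arF od -!val_eqE /= (gtn_eqF ltsi) => /esym s'i.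
  rewrite !andbF !andbT /=.
  by case: ltngtP s'i => //= _ _; case: (record s i); rewrite /= ?mulr1 ?mul1r.
have rF : record s i = false.
  by apply/negP=> /record_ge; rewrite leqNgt si.
have od : odd_index i = false.
  by case: (boolP (odd_index i)) => // /oD; rewrite leqNgt si.
move: s'iE; rewrite rF od -!val_eqE /= (ltn_eqF si) => /esym s'i.
rewrite !andbF !andbT /=.
by case: ltngtP s'i => //= _ _; case: (antirecord s i); rewrite /= ?mulr1 ?mul1r.
Qed.

(** A violated condition is an anti-excedance at an odd index or an excedance at an even one, of
    weight 0. *)
Lemma notin_Dperm_wt n (s : {perm 'I_(2 * n)}) : s \notin Dperm n ->
  \prod_i wt fix_wt exc_wt aexc_wt s i = 0.
Proof.
rewrite inE negb_forall => /existsP[i sDi]; rewrite (bigD1 i) //=.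
suff -> : wt fix_wt exc_wt aexc_wt s i = 0 by rewrite mul0r.
move: sDi; rewrite negb_and !negb_imply -!ltnNge => /orP[]/andP[odi si].
  by rewrite wt_aexc // /aexc_wt -/(odd_index i) odi.
by rewrite wt_exc // /exc_wt (negPf odi).
Qed.

Lemma Dpoly_path_sum n :
  Dpoly x1 x2 y1 y2 u1 u2 v1 v2 we wo ze zo n
    = path_sum fix_wt exc_wt aexc_wt (2 * n) 0 0.
Proof.
rewrite -perm_wt_sum [RHS](bigID (mem (Dperm n))) /=.
rewrite [X in _ + X]big1 ?addr0 => [|s]; last exact: notin_Dperm_wt.
by apply: eq_bigr => s; apply: Dperm_wt.
Qed.

Lemma Dpoly_Tfrac (alpha delta : nat -> R) :
  (forall h, alpha (2 * h).+1 = (x1 + u1 *+ h) * (y1 + v1 *+ h)) ->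
  (forall h, alpha (2 * h).+2 =
     (x2 + u2 *+ h + we) * (y2 + v2 *+ h + wo)) ->
  delta 1%N = ze * zo -> (forall j, delta j.+2 = 0) ->
  Dpoly x1 x2 y1 y2 u1 u2 v1 v2 we wo ze zo =1 Tfrac alpha delta.
Proof.
move=> aodd aeven d1 d0 n; rewrite Dpoly_path_sum.
rewrite -[0%N in X in path_sum _ _ _ _ X _](muln0 2).
rewrite (path_sum_Tfrac aodd aeven d1 d0) /= big_ord0 mul1r subn0.
exact: Tfrac_prod1.
Qed.

End Dpermutations.

Theorem theorem3p3 :
  let x1 : {mpoly int[12]} := 'X_(inord 0) in
  let x2 : {mpoly int[12]} := 'X_(inord 1) in
  let y1 : {mpoly int[12]} := 'X_(inord 2) in
  let y2 : {mpoly int[12]} := 'X_(inord 3) in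
  let u1 : {mpoly int[12]} := 'X_(inord 4) in
  let u2 : {mpoly int[12]} := 'X_(inord 5) in
  let v1 : {mpoly int[12]} := 'X_(inord 6) in
  let v2 : {mpoly int[12]} := 'X_(inord 7) in
  let we : {mpoly int[12]} := 'X_(inord 8) in
  let wo : {mpoly int[12]} := 'X_(inord 9) in
  let ze : {mpoly int[12]} := 'X_(inord 10) in
  let zo : {mpoly int[12]} := 'X_(inord 11) in
  forall alpha delta : nat -> {mpoly int[12]},
  (forall k : nat, (1 <= k)%N ->
     alpha (2 * k - 1)%N =
       (x1 + (k - 1)%N%:R * u1) * (y1 + (k - 1)%N%:R * v1)) ->
  (forall k : nat, (1 <= k)%N ->
     alpha (2 * k)%N =
       (x2 + (k - 1)%N%:R * u2 + we) * (y2 + (k - 1)%N%:R * v2 + wo)) ->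
  delta 1%N = ze * zo ->
  (forall n : nat, (2 <= n)%N -> delta n = 0) ->
  forall n : nat,
    Dpoly x1 x2 y1 y2 u1 u2 v1 v2 we wo ze zo n = Tfrac alpha delta n.
Proof.
move=> x1 x2 y1 y2 u1 u2 v1 v2 we wo ze zo alpha delta aodd aeven d1 d0.
apply: Dpoly_Tfrac => // [h|h|j]; last exact: d0.
  (* The shift [k = h.+1] turns the coefficients [k - 1] into [h]. *)
  have := aodd h.+1 isT; rewrite mulnS !subn1 /= => ->.
  by rewrite !mulr_natl.
have := aeven h.+1 isT; rewrite mulnS !subn1 /= => ->.
by rewrite !mulr_natl.
Qed.
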